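(* Let $a,b$ be coprime positive integers with $a>b\geqslant 1$ and let $\beta=a/b$. Let $\mathcal{A}$ be an alphabet of contiguous integers containing $0$ and at least one other element, of the minimal cardinality among such alphabets allowing parallel addition in base $\beta$. Then $\#\mathcal{A}=a+b$, and $\mathcal{A}$ is either $\{0,\ldots,a+b-1\}$, or $\{-a-b+1,\ldots,0\}$, or of the form $\{-d,\ldots,0,\ldots,a+b-1-d\}$ containing $\{-b,\ldots,0,\ldots,b\}$.
   Context: For a complex number $\beta$ with $|\beta|>1$ and a finite set $\mathcal{A}\subset\mathbb{C}$ containing $0$, let $\mathrm{Fin}_{\mathcal{A}}(\beta)=\{\sum_{j\in I}x_j\beta^j : I\subset\mathbb{Z}\text{ finite},\ x_j\in\mathcal{A}\}$. For finite alphabets $\mathcal{A},\mathcal{B}$, a map $\varphi:\mathcal{A}^{\mathbb{Z}}\to\mathcal{B}^{\mathbb{Z}}$ is $p$-local if there are integers $r,t\geqslant 0$ with $p=r+t+1$ and a map $\Phi:\mathcal{A}^p\to\mathcal{B}$ such that for every $u=(u_j)$ and $v=\varphi(u)$ one has $v_j=\Phi(u_{j+t}\cdots u_j\cdots u_{j-r})$ for all $j\in\mathbb{Z}$. A digit set conversion in base $\beta$ from $\mathcal{A}$ to $\mathcal{B}$ (both containing $0$) is a map $\varphi:\mathcal{A}^{\mathbb{Z}}\to\mathcal{B}^{\mathbb{Z}}$ such that whenever $u$ has finitely many nonzero entries, $v=\varphi(u)$ has finitely many nonzero entries and $\sum_j v_j\beta^j=\sum_j u_j\beta^j$. An alphabet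 $\mathcal{A}$ allows parallel addition in base $\beta$ if there is a digit set conversion in base $\beta$ from $\mathcal{A}+\mathcal{A}=\{x+y:x,y\in\mathcal{A}\}$ to $\mathcal{A}$ that is $p$-local for some $p$. *)

(* Defs.v *)
(* Complex numbers are R[i], for an arbitrary R : realType. *)
From HB Require Import structures.
From mathcomp Require Export all_boot all_order all_algebra finmap.
From mathcomp Require Export boolp classical_sets functions cardinality.
From mathcomp Require Export fsbigop set_interval reals.
From mathcomp Require Export complex.

Set Implicit Arguments.
Unset Strict Implicit.
Unset Printing Implicit Defensive.

Import Order.TTheory GRing.Theory Num.Theory.

Local Open Scope classical_set_scope.
Local Open Scope ring_scope.

Section ParallelAddition.
Variable R : realType.
Local Notation C := R[i].
Implicit Types A B : {fset C}.

(* An alphabet A : {fset C} also denotes the type of its digits, so that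
   int -> A is the set of bi-infinite words over A. *)

Definition finitely_many_nonzero A (u : int -> A) : Prop :=
  finite_set [set j : int | val (u j) != 0].

(* \sum_(_ \in _) is the sum over the support, and is 0 by convention when the
   support is infinite; it is only used here on words of finite support. *)
Definition word_value (beta : C) A (u : int -> A) : C :=
  \sum_(j \in [set: int]) (val (u j) * beta ^ j).

(* The argument of Phi is the window u_(j+t) ... u_j ... u_(j-r), of length
   p = r + t + 1, read by decreasing index. *)
Definition p_local A B (p : nat) (phi : (int -> A) -> (int -> B)) : Prop :=
  exists r t : nat, p = (r + t + 1)%N /\
  exists Phi : p.-tuple A -> B, forall (u : int -> A) (j : int),
    phi u j = Phi [tuple u (j + t%:Z - i%:Z) | i < p].

Definition digit_set_conversion (beta : C) A B
    (phi : (int -> A) -> (int -> B)) : Prop :=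
  [/\ 0 \in A, 0 \in B &
   forall u : int -> A, finitely_many_nonzero u ->
     finitely_many_nonzero (phi u) /\
     word_value beta (phi u) = word_value beta u].

Definition alphabet_sum A B : {fset C} := [fset (x + y)%R | x in A, y in B]%fset.

Definition allows_parallel_addition (beta : C) A : Prop :=
  exists phi : (int -> alphabet_sum A A) -> (int -> A),
    digit_set_conversion beta phi /\ exists p : nat, p_local p phi.

Definition int_range (m M : int) : set C :=
  [set k%:~R | k in [set k : int | m <= k <= M]].

Definition contiguous_integers A : Prop :=
  exists m M : int, [set` A] = int_range m M.

Definition contiguous_parallel_alphabet (beta : C) A : Prop :=
  [/\ contiguous_integers A, 0 \in A, exists2 x, x \in A & x != 0 &
      allows_parallel_addition beta A].

Definition minimal_contiguous_parallel_alphabet (beta : C) A : Prop :=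
  contiguous_parallel_alphabet beta A /\
  forall A', contiguous_parallel_alphabet beta A' -> (#|` A|%fset <= #|` A'|%fset)%N.

End ParallelAddition.

Arguments int_range : clear implicits.

(* Main.v *)
(** Two finite integer words u, v have the same value in base a/b iff u - v is
    a multiple of b X - a in Z[X, 1/X] (Gauss), that is, iff there are integer
    carries t, almost all zero, with v_j = u_j - a t_j + b t_(j-1).

    Suppose that {m, ..., M} with M > 0 allows parallel addition.  A block of
    digits 2 M, resp. 2 m, forces a carry >= 1, resp. <= 0.  If
    M - m + 1 < a + b, there is a digit x such that, along a following block
    of x's, carries >= 1 stay >= 1 and carries <= 0 stay <= 0.  By locality the
    two outputs agree far inside this block, where the difference e of the
    carries satisfies a e_j = b e_(j-1), so it is a positive integer decreasing
    for ever.  Hence M - m + 1 >= a + b.  If M < b, a carry >= 1 survives along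
    the digit 0, contradicting finiteness; hence b <= M.  The case m < 0 is
    symmetric.

    Conversely, on {-b, ..., a-1} the carries [u_j >= a - b], iterated, lower
    the large digits, and then the carries - [u_j < 0], iterated, raise the
    small ones. *)
Require Import Defs.
From mathcomp Require Import zify ring.

Import Order.TTheory GRing.Theory Num.Theory.
Local Open Scope classical_set_scope.
Local Open Scope ring_scope.

(** * Carries produced by a digit set conversion *)

Definition bounded_support (u : int -> int) : Prop :=
  exists N : nat, forall j : int, (N < `|j|)%N -> u j = 0.

Definition carry_equiv (a b : int) (u v : int -> int) : Prop :=
  exists2 t, bounded_support t &
    forall j : int, v j = u j - a * t j + b * t (j - 1).

(* F reads words on {2m, ..., 2M} and writes words on {m, ..., M}; only the
   finiteness of the dependence on the right is recorded. *)
Definition carry_conversion (a b m M : int) : Prop :=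
  exists (F : (int -> int) -> int -> int) (r : nat),
    (forall u, (forall j : int, 2 * m <= u j <= 2 * M) -> bounded_support u ->
       (forall j : int, m <= F u j <= M) /\ carry_equiv a b u (F u)) /\
    (forall u u' j, (forall i : int, j - r%:Z <= i -> u i = u' i) -> F u j = F u' j).

Lemma int_rect_from (P : int -> Prop) (n : int) :
  P n -> (forall j : int, n <= j -> P j -> P (j + 1)) -> forall j : int, n <= j -> P j.
Proof.
move=> Pn PS j nj; have -> : j = n + `|j - n|%N%:Z by lia.
elim: `|j - n|%N => [|k IHk]; first by rewrite addr0.
have -> : n + k.+1%:Z = n + k%:Z + 1 by lia.
by apply: PS => //; lia.
Qed.

(** Induction from the far left, where [t] vanishes: [- K <= t (j - 1)] gives [a * t j >= - b * K -
    (a - b) * K = - a * K]. *)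
Lemma carry_ge (a b K : int) (t : int -> int) :
  0 < b < a -> 0 <= K -> bounded_support t ->
  (forall j : int, b * t (j - 1) - (a - b) * K <= a * t j) -> forall j : int, - K <= t j.
Proof.
move=> ab K0 [N tN] step j.
have [jN|Nj] := ltP j (- N%:Z); first by rewrite tN; lia.
move: j Nj.
suff H : forall j : int, - N%:Z - 1 <= j -> - K <= t j by move=> j ?; apply: H; lia.
apply: int_rect_from => [|j _ IH]; first by rewrite tN; lia.
have := step (j + 1); rewrite (_ : j + 1 - 1 = j); last lia.
nia.
Qed.

Lemma carry_le (a b K : int) (t : int -> int) :
  0 < b < a -> 0 <= K -> bounded_support t ->
  (forall j : int, a * t j <= b * t (j - 1) + (a - b) * K) -> forall j : int, t j <= K.
Proof.
move=> ab K0 [N tN] step j; rewrite -lerN2.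
have stepN (i : int) : b * (- t (i - 1)) - (a - b) * K <= a * (- t i).
  by have := step i; lia.
apply: (carry_ge a b K (fun i : int => - t i)) => //.
by exists N => i /tN ->; rewrite oppr0.
Qed.

(** Since [b < a], a negative carry grows by at least 1 at each index, while a nonnegative one is
    followed by a carry at least [c]. From [- K], at most [K] steps reach 0 and one more reaches
    [c]. *)
Lemma carry_push (a b c K : int) (t : int -> int) :
  0 < b < a -> 0 <= c <= 1 -> 0 <= K -> - K <= t (- K - 2) ->
  (forall j : int, - K - 1 <= j < 0 -> b * t (j - 1) + c <= a * t j) -> c <= t (- 1).
Proof.
move=> ab c01 K0 tK step.
suff H : forall j : int, - K - 2 <= j -> j < 0 -> c <= t j \/ j + 2 <= t j.
  by case: (H (- 1) ltac:(lia) ltac:(lia)) => // t1; apply: le_trans t1; lia.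
apply: int_rect_from => [_|j jK IH j0]; first by right; lia.
have := step (j + 1); rewrite (_ : j + 1 - 1 = j); last lia.
move=> /(_ ltac:(lia)).
case: (IH ltac:(lia)) => [tj|tj] ts; first by left; nia.
have [tj0|tj0] := leP 0 (t j); first by left; nia.
by right; nia.
Qed.

(** The [y]'s fill the [K + 1] indices on which [carry_push] acts; the carry handed over to the
    block of [x]'s is [t (- 1)]. *)
Definition test_word (K n y x : int) (j : int) : int :=
  if (- K - 1 <= j) && (j < 0) then y else
  if (0 <= j) && (j < n) then x else 0.

Lemma test_word_support (K n y x : int) : bounded_support (test_word K n y x).
Proof.
exists (`|K| + `|n| + 2)%N => j; rewrite /test_word.
by case: ifP; [lia|case: ifP; lia].
Qed.

Lemma test_word_mid (K n y x j : int) : 0 <= j < n -> test_word K n y x j = x.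
Proof. by move=> jn; rewrite /test_word ifF ?ifT //; lia. Qed.

Lemma test_word_nneg (K n y y' x j : int) :
  0 <= j -> test_word K n y x j = test_word K n y' x j.
Proof. by move=> j0; rewrite /test_word; case: ifP => //; lia. Qed.

(** Changing all signs turns bounds obtained from [M > 0] into bounds for [m < 0]. *)
Lemma carry_conversion_opp (a b m M : int) :
  carry_conversion a b m M -> carry_conversion a b (- M) (- m).
Proof.
move=> [F [r [conv loc]]].
exists (fun u j => - F (fun i : int => - u i) j), r; split; last first.
  by move=> u u' j eq_u; congr (- _); apply: loc => i ?; rewrite eq_u.
move=> u ub [N uN].
have ubN (j : int) : 2 * m <= - u j <= 2 * M by have := ub j; lia.
have uNN : bounded_support (fun i : int => - u i).
  by exists N => j /uN ->; rewrite oppr0.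
have [Fb [t [N' tN] Ft]] := conv (fun i : int => - u i) ubN uNN.
split=> [j|]; first by have := Fb j => /=; lia.
exists (fun i : int => - t i); first by exists N' => j /tN ->; rewrite oppr0.
by move=> j; rewrite Ft; lia.
Qed.

Section CarryConversion.
Variables (a b m M : int).
Hypotheses (ab : 0 < b < a) (m0 : m <= 0) (M0 : 0 < M).
Variables (F : (int -> int) -> int -> int).
Hypothesis conv : forall u, (forall j : int, 2 * m <= u j <= 2 * M) ->
  bounded_support u ->
  (forall j : int, m <= F u j <= M) /\ carry_equiv a b u (F u).

(** As [m <= 0 < M], this bounds the distance between an input digit in [[2m, 2M]] and an output
    digit in [[m, M]]; as [a - b >= 1], it then bounds the carries too. *)
Let K : int := 2 * (M - m).

Lemma test_word_carry (n y x : int) :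
  2 * m <= y <= 2 * M -> 2 * m <= x <= 2 * M ->
  exists t, [/\ bounded_support t, forall j : int, - K <= t j <= K,
    forall j : int, m <= F (test_word K n y x) j <= M &
    forall j : int, F (test_word K n y x) j =
      test_word K n y x j - a * t j + b * t (j - 1)].
Proof.
move=> yb xb.
have ub j : 2 * m <= test_word K n y x j <= 2 * M.
  by rewrite /test_word; case: ifP; [lia|case: ifP; lia].
have [Fb [t ts Ft]] := conv _ ub (test_word_support K n y x).
exists t; split=> // j; apply/andP; split.
- apply: (carry_ge a b) => // [|i]; first lia.
  by have := Ft i; have := Fb i; have := ub i; rewrite /K; nia.
- apply: (carry_le a b) => // [|i]; first lia.
  by have := Ft i; have := Fb i; have := ub i; rewrite /K; nia.
Qed.

(** Along the block, [2 * M] exceeds each output digit by at least [M >= 1], so [carry_push] applies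
    with [c = 1]. *)
Lemma max_test_word_carry (n x : int) (t : int -> int) :
  (forall j : int, - K <= t j) ->
  (forall j : int, m <= F (test_word K n (2 * M) x) j <= M) ->
  (forall j : int, F (test_word K n (2 * M) x) j =
     test_word K n (2 * M) x j - a * t j + b * t (j - 1)) -> 1 <= t (- 1).
Proof.
move=> tK Fb Ft; apply: (carry_push a b 1 K) => //; first lia.
move=> j jK; have := Ft j; have := Fb j.
by rewrite /test_word jK; lia.
Qed.

(** Here [- t] is pushed, with [c = 0] only: the guaranteed surplus [- m] may vanish. *)
Lemma min_test_word_carry (n x : int) (t : int -> int) :
  (forall j : int, t j <= K) ->
  (forall j : int, m <= F (test_word K n (2 * m) x) j <= M) ->
  (forall j : int, F (test_word K n (2 * m) x) j =
     test_word K n (2 * m) x j - a * t j + b * t (j - 1)) -> t (- 1) <= 0.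
Proof.
move=> tK Fb Ft; rewrite -oppr_ge0.
apply: (carry_push a b 0 K (fun j : int => - t j)) => //; first lia.
  by rewrite lerN2.
move=> j jK; have := Ft j; have := Fb j.
by rewrite /test_word jK; lia.
Qed.

Lemma base_den_le_max_digit : b <= M.
Proof.
rewrite leNgt; apply/negP => Mb.
(* With [n = 0] the word is zero from index 0 on. *)
have [||t [[N tN] tK Fb Ft]] := test_word_carry 0 (2 * M) 0; [lia|lia|].
have t1 : 1 <= t (- 1).
  by apply: max_test_word_carry Fb Ft => j; have := tK j; lia.
suff /(_ N.+1) : forall j : int, - 1 <= j -> 1 <= t j by rewrite tN; lia.
apply: int_rect_from => // j j1 IH.
have := Ft (j + 1); have := Fb (j + 1).
rewrite (_ : j + 1 - 1 = j) /test_word; last lia.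
case: ifP; [lia|case: ifP; [lia|move=> _ _; nia]].
Qed.

Variable r : nat.
Hypothesis loc : forall u u' j, (forall i : int, j - r%:Z <= i -> u i = u' i) ->
  F u j = F u' j.

Lemma digit_count_lower_bound : a + b <= M - m + 1.
Proof.
rewrite leNgt; apply/negP => small.
(* The lower bound [x - M + b >= 1] keeps carries at least 1; the upper bound [x - m <= a - 1] keeps
   carries at most 0. Both can hold because [M - m + 1 < a + b]. *)
have [x /andP[x1 x2] xb] :
    exists2 x : int, M + 1 - b <= x <= m - 1 + a & 2 * m <= x <= 2 * M.
  by exists (Num.max (M + 1 - b) (2 * m)); lia.
(* The gap [t - s] is at most [2 * K] at index [r - 1] and then drops at each index; this length
   makes its upper bound negative at [n - 1]. *)
pose n : int := r%:Z + 2 * K + 2.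
have [||s [_ sK Fs Es]] := test_word_carry n (2 * m) x; [lia|lia|].
have [||t [_ tK Ft Et]] := test_word_carry n (2 * M) x; [lia|lia|].
have s0 : s (- 1) <= 0.
  by apply: min_test_word_carry Fs Es => j; have := sK j; lia.
have t1 : 1 <= t (- 1).
  by apply: max_test_word_carry Ft Et => j; have := tK j; lia.
have gap : forall j : int, - 1 <= j -> j < n -> s j <= 0 /\ 1 <= t j.
  apply: int_rect_from => // j j1 IH jn.
  have {IH} [|sj tj] := IH; first lia.
  have := Es (j + 1); have := Fs (j + 1); have := Et (j + 1); have := Ft (j + 1).
  rewrite !test_word_mid; [|lia|lia].
  rewrite (_ : j + 1 - 1 = j); last lia.
  by move=> *; split; nia.
(* From index [r] on, the outputs see only indices at least 0, where the two words coincide. *)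
have eqF j : r%:Z <= j ->
    F (test_word K n (2 * M) x) j = F (test_word K n (2 * m) x) j.
  move=> rj; apply: loc => i ir.
  by apply: test_word_nneg; lia.
suff /(_ (n - 1)) : forall j : int, r%:Z - 1 <= j -> j < n ->
    t j - s j <= 2 * K - (j - r%:Z + 1).
  by have [||] := gap (n - 1); lia.
apply: int_rect_from => [_|j rj IH jn].
  by have := sK (r%:Z - 1); have := tK (r%:Z - 1); lia.
have [||sj tj] := gap j; [lia|lia|].
have {IH} := IH ltac:(lia).
have := eqF (j + 1) ltac:(lia); rewrite Es Et (_ : j + 1 - 1 = j); last lia.
by rewrite (test_word_nneg _ _ _ (2 * m)); [move=> *; nia|lia].
Qed.

End CarryConversion.

(** * Carries and values in base a/b *)

Lemma bounded_supportP (u : int -> int) :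
  bounded_support u <-> finite_set [set j | u j != 0].
Proof.
split=> [[N uN]|fin_u].
  apply: (@sub_finite_set _ _ [set k%:Z - N%:Z | k in `I_(2 * N + 1)]).
    move=> /= j uj; exists `|(j + N%:Z)%R|%N; last first.
      by have := uN j; case: ltnP => [_ /(_ isT) u0|]; [rewrite u0 eqxx in uj|lia].
    by have := uN j; case: ltnP => [_ /(_ isT) u0|]; [rewrite u0 eqxx in uj|rewrite /=; lia].
  exact/finite_image/finite_II.
pose S : {fset int} := fset_set [set j | u j != 0].
exists (\sum_(j <- S) `|j|)%N => j; case: (eqVneq (u j) 0) => // uj.
rewrite ltnNge => /negP[]; rewrite (big_rem j) ?leq_addr //.
by rewrite in_fset_set // inE.
Qed.

Lemma bounded_supportD (u v : int -> int) :
  bounded_support u -> bounded_support v -> bounded_support (fun j => u j + v j).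
Proof.
move=> [N uN] [N' vN]; exists (maxn N N') => j jN.
by rewrite uN ?vN ?addr0 //; lia.
Qed.

Lemma fsum_bounded (V : zmodType) (f : int -> V) (N : nat) :
  (forall j : int, (N < `|j|)%N -> f j = 0) ->
  \sum_(j \in [set: int]) f j = \sum_(i < 2 * N + 1) f (i%:Z - N%:Z).
Proof.
move=> fN; rewrite (fsbig_ord _ _ (fun i : nat => f (i%:Z - N%:Z))).
rewrite -(fsbig_image `I_(2 * N + 1) (fun i : nat => i%:Z - N%:Z) f); last first.
  by move=> i j _ _; lia.
apply/esym/fsbig_widen => // j [_ jN] /=; apply: fN.
rewrite ltnNge; apply/negP => Nj; apply: jN.
by exists `|(j + N%:Z)%R|%N => /=; lia.
Qed.

Section RationalBase.
Variables (C : numFieldType) (a b : nat).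
Hypotheses (a_gt0 : (0 < a)%N) (b_gt0 : (0 < b)%N) (co_ab : coprime a b).
Let beta : C := a%:R / b%:R.

(** The homogenised partial sum, with terms [z i * a ^ i * b ^ (k - 1 - i)] for [i < k]; it stays in
    the integers. *)
Fixpoint scaled_sum (z : nat -> int) (k : nat) : int :=
  if k is l.+1 then b%:Z * scaled_sum z l + z l * a%:Z ^+ l else 0.

Lemma scaled_sumE (z : nat -> int) (k : nat) :
  (scaled_sum z k)%:~R * b%:R = b%:R ^+ k * \sum_(i < k) (z i)%:~R * beta ^+ i.
Proof.
have b0 : b%:R != 0 :> C by rewrite pnatr_eq0 -lt0n.
elim: k => [|k IHk] /=; first by rewrite big_ord0 !mul0r mulr0.
rewrite big_ord_recr /= intrD !intrM mulrDl -mulrA IHk mulrDr exprS.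
rewrite !pmulrn -!mulrA; congr (_ + _).
rewrite rmorphXn /= /beta expr_div_n.
by field; rewrite expf_neq0.
Qed.

(** Terms of index at least [k] contain [a ^ k], so [scaled_sum z (k + l)] is
    [b ^ l * scaled_sum z k] modulo [a ^ k]. At [k + l = n] the left side is 0, and [b] is prime to
    [a]. *)
Lemma dvd_scaled_sum (z : nat -> int) (n k : nat) :
  (forall i, (n <= i)%N -> z i = 0) -> scaled_sum z n = 0 ->
  (a%:Z ^+ k %| scaled_sum z k)%Z.
Proof.
move=> zn Sn.
have S0 i : (n <= i)%N -> scaled_sum z i = 0.
  move=> /subnKC <-; elim: (i - n)%N => [|l IHl]; first by rewrite addn0.
  by rewrite addnS /= IHl zn ?leq_addr // mulr0 mul0r.
have [/S0 ->|kn] := leqP n k; first exact: dvdz0.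
have : (a%:Z ^+ k %| b%:Z ^+ (n - k) * scaled_sum z k)%Z.
  suff H l : (a%:Z ^+ k %| scaled_sum z (k + l) - b%:Z ^+ l * scaled_sum z k)%Z.
    by have := H (n - k)%N; rewrite subnKC ?(ltnW kn) // Sn sub0r dvdzE abszN.
  elim: l => [|l IHl]; first by rewrite addn0 mul1r subrr dvdz0.
  rewrite addnS /= addrAC exprS -mulrA -mulrBr.
  by rewrite rpredD ?dvdz_mull // exprD dvdz_mulr.
by rewrite Gauss_dvdzr // coprimezXl // coprimezXr.
Qed.

Lemma vanishing_sum_carry (z : nat -> int) (n : nat) :
  (forall i, (n <= i)%N -> z i = 0) ->
  \sum_(i < n) (z i)%:~R * beta ^+ i = 0 ->
  exists c : nat -> int, [/\ c 0%N = 0, forall k, (n <= k)%N -> c k = 0 &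
    forall k, a%:Z * c k.+1 = z k + b%:Z * c k].
Proof.
move=> zn sum0.
have S0 i : (n <= i)%N -> scaled_sum z i = 0.
  move=> ni; have := scaled_sumE z i.
  have -> : \sum_(j < i) (z j)%:~R * beta ^+ j = 0.
    rewrite -(subnKC ni) big_split_ord /= sum0 add0r big1 // => j _.
    by rewrite zn ?leq_addr // mul0r.
  rewrite mulr0 => /eqP; rewrite mulf_eq0 pnatr_eq0 intr_eq0.
  by rewrite eqn0Ngt b_gt0 orbF => /eqP.
have dvdS k := dvd_scaled_sum z n k zn (S0 n (leqnn n)).
have aX k : a%:Z ^+ k != 0 by rewrite expf_neq0 // -lt0n.
(* The recurrence of [scaled_sum] divided by [a ^ k] is the carry equation. *)
exists (fun k => (scaled_sum z k %/ a%:Z ^+ k)%Z); split=> [|k nk|k].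
- by rewrite div0z.
- by rewrite S0 // div0z.
have SK l : (scaled_sum z l %/ a%:Z ^+ l)%Z * a%:Z ^+ l = scaled_sum z l.
  exact/divzK/dvdS.
apply: (mulIf (aX k)); rewrite mulrDl -!mulrA SK mulrCA -exprS SK /=.
by rewrite addrC.
Qed.

Lemma vanishing_value_carry (z : int -> int) :
  bounded_support z -> \sum_(j \in [set: int]) (z j)%:~R * beta ^ j = 0 ->
  exists2 t, bounded_support t &
    forall j : int, a%:Z * t j = z j + b%:Z * t (j - 1).
Proof.
move=> [N zN]; rewrite (fsum_bounded _ _ N) => [sum0|j /zN ->]; last first.
  by rewrite mul0r.
have beta0 : beta != 0.
  by rewrite mulf_neq0 ?invr_eq0 // pnatr_eq0 -lt0n.
pose z' (i : nat) : int := z (i%:Z - N%:Z).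
have z'n i : (2 * N + 1 <= i)%N -> z' i = 0 by move=> ni; apply: zN; lia.
have [|c [c0 cn cS]] := vanishing_sum_carry z' (2 * N + 1) z'n.
  apply: (mulIf (expfz_neq0 (- N%:Z) beta0)); rewrite mul0r -[RHS]sum0 big_distrl /=.
  by apply: eq_bigr => i _; rewrite expfzDr // mulrA.
(* The shift by 1 is there because [c k] enters position [k], whereas [t j] leaves position [j];
   [c 0 = 0] joins the two branches. *)
exists (fun j : int => if 0 <= j + N%:Z then c `|(j + N%:Z + 1)%R|%N else 0).
  by exists (N + 1)%N => j jN; case: ifP => // ?; rewrite cn //; lia.
move=> j; have [j0|j0|j0] := ltrgtP (j + N%:Z) (-1).
- rewrite !ifF; [|lia|lia]; rewrite zN; [lia|lia].
- rewrite ifT; last lia.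
  have -> : `|(j + N%:Z + 1)%R|%N = `|(j + N%:Z)%R|%N.+1 by lia.
  rewrite cS; congr (_ + _ * _); first by congr (z _); lia.
  case: ifP => [j1|j1]; first by congr c; lia.
  by have -> : `|(j + N%:Z)%R|%N = 0%N by lia.
- rewrite !ifF; [|lia|lia]; rewrite zN; [lia|lia].
Qed.

Lemma carry_vanishing_value (z t : int -> int) :
  bounded_support t -> (forall j : int, a%:Z * t j = z j + b%:Z * t (j - 1)) ->
  \sum_(j \in [set: int]) (z j)%:~R * beta ^ j = 0.
Proof.
move=> [N tN] zt.
have b0 : b%:R != 0 :> C by rewrite pnatr_eq0 -lt0n.
have beta0 : beta != 0.
  by rewrite mulf_neq0 ?invr_eq0 // pnatr_eq0 -lt0n.
have bbeta : b%:R * beta = a%:R by rewrite mulrC divfK.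
have zE (j : int) : z j = a%:Z * t j - b%:Z * t (j - 1) by rewrite zt addrK.
rewrite (fsum_bounded _ _ N.+1); last first.
  by move=> j jN; rewrite zE !tN ?mulr0 ?subr0 ?mul0r //; lia.
(* As [a = b * beta], each term [z j * beta ^ j] is [b * t j * beta ^ (j + 1) - b * t (j - 1) * beta
   ^ j], and the sum telescopes. *)
pose f (k : nat) : C := b%:R * (t (k%:Z - N.+1%:Z - 1))%:~R * beta ^ (k%:Z - N.+1%:Z).
have -> : \sum_(i < 2 * N.+1 + 1) (z (i%:Z - N.+1%:Z))%:~R * beta ^ (i%:Z - N.+1%:Z) =
    \sum_(0 <= i < 2 * N.+1 + 1) (f i.+1 - f i).
  rewrite big_mkord; apply: eq_bigr => i _; rewrite zE /f.
  have -> : i.+1%:Z - N.+1%:Z - 1 = i%:Z - N.+1%:Z :> int by lia.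
  have -> : i.+1%:Z - N.+1%:Z = 1 + (i%:Z - N.+1%:Z) :> int by lia.
  rewrite (expfzDr 1 _ beta0) expr1z rmorphB /= !rmorphM /= -!pmulrn -bbeta.
  by ring.
rewrite telescope_sumr; last lia.
by rewrite /f !tN ?mulr0 ?mul0r ?subrr //; lia.
Qed.

Lemma value_eq_carryP (u v : int -> int) :
  bounded_support u -> bounded_support v ->
  (\sum_(j \in [set: int]) (v j)%:~R * beta ^ j =
   \sum_(j \in [set: int]) (u j)%:~R * beta ^ j) <->
  carry_equiv a b u v.
Proof.
move=> bu bv; have [[N uN] [N' vN]] := (bu, bv).
have buv : bounded_support (fun j : int => u j + - v j).
  by apply: bounded_supportD => //; exists N' => j /vN ->; rewrite oppr0.
have -> : (\sum_(j \in [set: int]) (v j)%:~R * beta ^ j =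
   \sum_(j \in [set: int]) (u j)%:~R * beta ^ j) =
   (\sum_(j \in [set: int]) (u j - v j)%:~R * beta ^ j = 0).
  have bd (w : int -> int) : (forall j : int, (maxn N N' < `|j|)%N -> w j = 0) ->
      \sum_(j \in [set: int]) (w j)%:~R * beta ^ j =
      \sum_(i < 2 * maxn N N' + 1) (w (i%:Z - (maxn N N')%:Z))%:~R *
        beta ^ (i%:Z - (maxn N N')%:Z).
    move=> wN; apply: (fsum_bounded _ (fun j => (w j)%:~R * beta ^ j)).
    by move=> j /wN ->; rewrite mul0r.
  rewrite !bd; do ?[by move=> j jN; rewrite ?uN ?vN ?subr0 //; lia].
  under [X in _ = (X = 0)]eq_bigr do rewrite rmorphB /= mulrBl.
  rewrite sumrB; apply/propext; split=> [->|/eqP]; first by rewrite subrr.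
  by rewrite subr_eq0 => /eqP ->.
split=> [/(vanishing_value_carry _ buv)[t bt tE]|[t bt tE]].
  by exists t => // j; have := tE j; lia.
by apply: carry_vanishing_value bt _ => j; have := tE j; lia.
Qed.

End RationalBase.

(** * Digit set conversions as carry conversions *)

Section Alphabets.
Variables (R : realType) (a b : nat).
Hypotheses (a_gt0 : (0 < a)%N) (b_gt0 : (0 < b)%N) (co_ab : coprime a b).
Local Notation C := R[i].
Let beta : C := a%:R / b%:R.

(** A left inverse of the embedding of the integers; other complex numbers go to the default 0. *)
Definition int_digit (x : C) : int := xget 0 [set k : int | k%:~R = x].

Lemma int_digitK (k : int) : int_digit k%:~R = k.
Proof.
rewrite /int_digit; case: xgetP => [l _ /= /intr_inj //|/(_ k)].
by move=> /(_ erefl).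
Qed.

Variables (A : {fset C}) (m M : int).
Hypotheses (A_range : [set` A] = int_range R m M) (A0 : 0 \in A).

Lemma mem_int_range (k : int) : (k%:~R \in A) = (m <= k <= M).
Proof.
apply/idP/idP => [kA|km].
  have : [set` A] k%:~R by [].
  by rewrite A_range => -[l lmM /intr_inj <-].
have : int_range R m M k%:~R by exists k.
by rewrite -A_range.
Qed.

Lemma int_digitE (x : C) : x \in A -> x = (int_digit x)%:~R.
Proof.
move=> xA; have : [set` A] x by [].
by rewrite A_range => -[k _ <-]; rewrite int_digitK.
Qed.

Lemma range_le0 : m <= 0 <= M.
Proof. by rewrite -mem_int_range mulr0z. Qed.

Lemma mem_alphabet_sum (x : C) :
  (x \in alphabet_sum A A) <-> exists2 k : int, x = k%:~R & 2 * m <= k <= 2 * M.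
Proof.
have mM := range_le0.
split=> [/imfset2P[y /= yA [z /= zA ->]]|[k -> kmM]].
  move: (yA) (zA); rewrite (int_digitE y yA) (int_digitE z zA) !mem_int_range.
  by move=> yb zb; exists (int_digit y + int_digit z); [rewrite intrD|lia].
have [l lk] : exists l : int, m <= l <= M /\ m <= k - l <= M.
  have [kM|Mk] := leP k (m + M); first by exists m; lia.
  by exists M; lia.
apply/imfset2P; exists l%:~R; first by rewrite /= mem_int_range; lia.
exists (k - l)%:~R; first by rewrite /= mem_int_range; lia.
by rewrite -intrD; congr (_%:~R); lia.
Qed.

Lemma alphabet_sum0 : 0 \in alphabet_sum A A.
Proof.
by apply/mem_alphabet_sum; exists 0; [rewrite mulr0z|have := range_le0; lia].
Qed.

Lemma word_valueE (B : {fset C}) (u : int -> B) (U : int -> int) :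
  (forall j, val (u j) = (U j)%:~R) ->
  word_value beta u = \sum_(j \in [set: int]) (U j)%:~R * beta ^ j.
Proof. by move=> uU; apply: eq_fsbigr => j _; rewrite uU. Qed.

Lemma finitely_many_nonzeroP (B : {fset C}) (u : int -> B) (U : int -> int) :
  (forall j, val (u j) = (U j)%:~R) ->
  finitely_many_nonzero u <-> bounded_support U.
Proof.
move=> uU; rewrite bounded_supportP /finitely_many_nonzero.
suff -> : [set j | val (u j) != 0] = [set j | U j != 0] by [].
by apply/seteqP; split=> j /=; rewrite uU intr_eq0.
Qed.

Lemma carry_conversion_of_parallel :
  allows_parallel_addition beta A -> carry_conversion a b m M.
Proof.
move=> [phi [[_ _ conv] [p [r [s [pE [Phi phiE]]]]]]].
(* Values outside the alphabet are read as the digit 0, which makes the conversion total on integer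
   words. *)
pose word (u : int -> int) (j : int) : alphabet_sum A A :=
  insubd [` alphabet_sum0]%fset (u j)%:~R.
exists (fun u j => int_digit (val (phi (word u) j))), r; split; last first.
  move=> u u' j uu'; congr (int_digit (val _)); rewrite !phiE; congr Phi.
  apply: eq_from_tnth => i; rewrite !tnth_mktuple /word uu' //.
  by have := ltn_ord i; lia.
move=> u ub bu.
have wE (j : int) : val (word u j) = (u j)%:~R.
  by apply: insubdK; apply/mem_alphabet_sum; exists (u j).
pose v (j : int) := int_digit (val (phi (word u) j)).
have vE (j : int) : val (phi (word u) j) = (v j)%:~R by apply/int_digitE/valP.
split=> [j|]; first by rewrite -mem_int_range -vE; exact: valP.
have [fv valv] := conv _ ((finitely_many_nonzeroP _ _ _ wE).2 bu).
apply/(value_eq_carryP C) => //; first exact/(finitely_many_nonzeroP _ _ _ vE).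
by rewrite -(word_valueE _ _ _ vE) valv (word_valueE _ _ _ wE).
Qed.

(** Allowing [j] and [j'] to differ adds shift invariance to the finite dependence. *)
Definition right_local (n : nat) (G : (int -> int) -> int -> int) : Prop :=
  forall u u' (j j' : int),
    (forall i : nat, (i <= n)%N -> u (j - i%:Z) = u' (j' - i%:Z)) ->
    G u j = G u' j'.

Lemma parallel_of_carry_equiv (n : nat) (G : (int -> int) -> int -> int) :
  right_local n G ->
  (forall u, (forall j : int, 2 * m <= u j <= 2 * M) -> bounded_support u ->
     [/\ forall j : int, m <= G u j <= M, bounded_support (G u) &
         carry_equiv a b u (G u)]) ->
  allows_parallel_addition beta A.
Proof.
move=> locG convG.
pose out (k : int) : A := insubd [` A0]%fset k%:~R.
pose phi (u : int -> alphabet_sum A A) (j : int) : A :=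
  out (G (fun i => int_digit (val (u i))) j).
exists phi; split.
  split=> [||u fu]; [exact: alphabet_sum0|exact: A0|].
  pose U (j : int) := int_digit (val (u j)).
  have uU (j : int) : val (u j) = (U j)%:~R /\ 2 * m <= U j <= 2 * M.
    have /mem_alphabet_sum[k uk kmM] := valP (u j).
    by rewrite /U uk int_digitK.
  have uE (j : int) := (uU j).1.
  have bU := (finitely_many_nonzeroP _ _ _ uE).1 fu.
  have [GmM bG carryG] := convG U (fun j => (uU j).2) bU.
  have vE (j : int) : val (phi u j) = (G U j)%:~R.
    by apply: insubdK; rewrite mem_int_range.
  split; first exact/(finitely_many_nonzeroP _ _ _ vE).
  by rewrite (word_valueE _ _ _ vE) (word_valueE _ _ _ uE); apply/(value_eq_carryP C).
exists (n + 0 + 1)%N, n, 0%N; split=> //.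
pose z0 : alphabet_sum A A := [` alphabet_sum0]%fset.
(* Entry [i] of the window is [u (j - i)]. The window is laid out as a word with entry [i] at index
   [- i], and [G] is evaluated at 0, where it reads only these indices. *)
exists (fun w => out (G (fun k => int_digit (val (nth z0 w `|k|%N))) 0)) => u j.
congr out; apply: locG => i ilen; congr (int_digit (val _)).
have ilt : (i < n + 0 + 1)%N by lia.
have -> : `|(0 - i%:Z)%R|%N = Ordinal ilt :> nat by rewrite /=; lia.
by rewrite nth_mktuple /=; congr u; lia.
Qed.

End Alphabets.

(** * The alphabet {-b, ..., a-1} *)

Section CarryRules.
Variables a b : int.

Lemma carry_equiv_refl (u : int -> int) : carry_equiv a b u u.
Proof. by exists (fun=> 0) => [|j]; [exists 0%N|rewrite !mulr0 subr0 addr0]. Qed.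

Lemma carry_equiv_trans (u v w : int -> int) :
  carry_equiv a b u v -> carry_equiv a b v w -> carry_equiv a b u w.
Proof.
move=> [s bs sE] [t bt tE]; exists (fun j : int => s j + t j) => [|j].
  exact: bounded_supportD.
by rewrite tE sE; lia.
Qed.

Lemma carry_equiv_support (u v : int -> int) :
  carry_equiv a b u v -> bounded_support u -> bounded_support v.
Proof.
move=> [t [N tN] vE] [N' uN]; exists (N + N').+1 => j jN.
by rewrite vE uN ?tN ?mulr0 //; lia.
Qed.

(** One simultaneous round of carries, each chosen from the digit at its own position alone. *)
Definition carry_rule (q : int -> int) (u : int -> int) (j : int) : int :=
  u j - a * q (u j) + b * q (u (j - 1)).

Lemma carry_rule_local (q : int -> int) (k : nat) :
  right_local k (iter k (carry_rule q)).
Proof.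
elim: k => [|k IHk] u u' j j' uu'.
  by have := uu' 0%N isT; rewrite !subr0.
have uk : iter k (carry_rule q) u j = iter k (carry_rule q) u' j'.
  by apply: IHk => i ik; apply: uu'; lia.
have uk1 : iter k (carry_rule q) u (j - 1) = iter k (carry_rule q) u' (j' - 1).
  apply: IHk => i ik; have := uu' i.+1 ik.
  by congr (u _ = u' _); lia.
by rewrite !iterS /carry_rule uk uk1.
Qed.

Lemma right_local_comp (n n' : nat) (G G' : (int -> int) -> int -> int) :
  right_local n G -> right_local n' G' -> right_local (n + n') (G \o G').
Proof.
move=> locG locG' u u' j j' uu' /=; apply: locG => i iln.
apply: locG' => i' iln'; have := uu' (i + i')%N ltac:(lia).
by congr (u _ = u' _); lia.
Qed.

Lemma carry_rule_equiv (q : int -> int) (k : nat) (u : int -> int) :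
  q 0 = 0 -> bounded_support u -> carry_equiv a b u (iter k (carry_rule q) u).
Proof.
move=> q0 bu; elim: k => [|k IHk]; first exact: carry_equiv_refl.
apply: (carry_equiv_trans _ _ _ IHk).
have [N uN] := carry_equiv_support _ _ IHk bu.
exists (fun j : int => q (iter k (carry_rule q) u j)) => //.
by exists N => j /uN ->.
Qed.

Hypothesis ab : 0 < b < a.

Definition high_carry (x : int) : int := if a - b <= x then 1 else 0.

Definition low_carry (x : int) : int := if x < 0 then -1 else 0.

(** In one round, a digit at least [a - b] loses [a] and gains at most [b]: it drops by [a - b] or
    more and stays at least [- b]. A smaller digit gains at most [b] and stays below [a]. *)
Lemma high_carry_bounds (k : nat) (m M : int) (u : int -> int) :
  m <= - b -> (forall j : int, m <= u j <= M) ->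
  forall j : int,
    m <= iter k (carry_rule high_carry) u j <= Num.max (a - 1) (M - k%:Z * (a - b)).
Proof.
move=> mb ub; elim: k => [|k IHk] j; first by have := ub j; rewrite /=; lia.
have := IHk j; rewrite iterS; move: (iter k _ u) => w; rewrite /carry_rule /high_carry.
rewrite intS mulrDl mul1r; move: (k%:Z * (a - b)) => d.
by case: ifP => ?; case: ifP => ?; lia.
Qed.

(** In one round, a negative digit gains [a] and loses at most [b], so it rises by at least [a - b]
    and stays below [a]; a nonnegative one falls no lower than [- b]. *)
Lemma low_carry_bounds (k : nat) (m M : int) (u : int -> int) :
  a - 1 <= M -> (forall j : int, m <= u j <= M) ->
  forall j : int,
    Num.min (- b) (m + k%:Z * (a - b)) <= iter k (carry_rule low_carry) u j <= M.
Proof.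
move=> aM ub; elim: k => [|k IHk] j; first by have := ub j; rewrite /=; lia.
have := IHk j; rewrite iterS; move: (iter k _ u) => w; rewrite /carry_rule /low_carry.
rewrite intS mulrDl mul1r; move: (k%:Z * (a - b)) => d.
by case: ifP => ?; case: ifP => ?; lia.
Qed.

End CarryRules.

Lemma symmetric_alphabet_parallel (R : realType) (a b : nat) (A : {fset R[i]}) :
  (0 < b)%N -> (b < a)%N -> coprime a b ->
  [set` A] = int_range R (- b%:Z) (a%:Z - 1) -> 0 \in A ->
  allows_parallel_addition (a%:R / b%:R : R[i]) A.
Proof.
move=> b0 ba co_ab AE A0; have a0 : (0 < a)%N by lia.
have ab : 0 < b%:Z < a%:Z by lia.
(* Each round gains at least [a - b >= 1], so [a] rounds absorb the excess [a - 1] at the top, and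
   [a] more the excess [b] at the bottom. *)
apply: (parallel_of_carry_equiv R a b a0 b0 co_ab A _ _ AE A0 (a + a)
  (iter a (carry_rule a b (low_carry)) \o iter a (carry_rule a b (high_carry a b)))).
  by apply: right_local_comp; apply: carry_rule_local.
move=> u ub bu.
have equ : carry_equiv a b u (iter a (carry_rule a b (high_carry a b)) u).
  by apply: carry_rule_equiv => //; rewrite /high_carry ifF //; lia.
have equ' := carry_rule_equiv a b low_carry a _ erefl (carry_equiv_support _ _ _ _ equ bu).
split=> [j||].
- have b1 : 2 * - b%:Z <= - b%:Z by lia.
  have ub1 (j' : int) : 2 * - b%:Z <= iter a (carry_rule a b (high_carry a b)) u j' <= a%:Z - 1.
    by have := high_carry_bounds a b ab a _ _ u b1 ub j'; nia.
  by have /= := low_carry_bounds a b ab a _ _ _ (lexx _) ub1 j; nia.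
- exact/(carry_equiv_support _ _ _ _ equ')/(carry_equiv_support _ _ _ _ equ bu).
- exact: carry_equiv_trans equ equ'.
Qed.

(** * The minimal alphabets *)

Section IntFset.
Variable R : realType.

Definition int_fset (m : int) (n : nat) : {fset R[i]} :=
  [fset (m + (i : 'I_n)%:Z)%:~R | i in 'I_n]%fset.

Lemma int_fsetE (m M : int) (n : nat) :
  M - m + 1 = n%:Z -> [set` int_fset m n] = int_range R m M.
Proof.
move=> nE; apply/seteqP; split=> x /=.
  by case/imfsetP => i _ ->; exists (m + i%:Z) => //=; have := ltn_ord i; lia.
case=> k /= km <-; have kn : (`|(k - m)%R| < n)%N by lia.
apply/imfsetP; exists (Ordinal kn) => //=; congr (_%:~R); lia.
Qed.

Lemma card_int_fset (m : int) (n : nat) : #|` int_fset m n| = n.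
Proof.
rewrite card_imfset /=; last first.
  by move=> i j /intr_inj ij; apply: val_inj => /=; lia.
by rewrite -cardE card_ord.
Qed.

Lemma card_int_range (A : {fset R[i]}) (m M : int) :
  [set` A] = int_range R m M -> m <= M + 1 -> #|` A|%:Z = M - m + 1.
Proof.
move=> AE mM; have nE : M - m + 1 = `|(M - m + 1)%R|%N%:Z by lia.
have -> : A = int_fset m `|(M - m + 1)%R|%N.
  apply/fsetP => x; have : [set` A] x = [set` int_fset m `|(M - m + 1)%R|%N] x.
    by rewrite AE (int_fsetE m M).
  by move=> /= /propeqP[AI IA]; apply/idP/idP.
by rewrite card_int_fset.
Qed.

End IntFset.

(** The case [0 < M] is direct and the case [m < 0] is its mirror image; at least one of them
    occurs. *)
Lemma carry_conversion_bounds (a b m M : int) :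
  0 < b < a -> m <= 0 <= M -> (m < 0) || (0 < M) -> carry_conversion a b m M ->
  [/\ a + b <= M - m + 1, 0 < M -> b <= M & m < 0 -> m <= - b].
Proof.
move=> ab mM; have main m' M' : m' <= 0 -> 0 < M' -> carry_conversion a b m' M' ->
    a + b <= M' - m' + 1 /\ b <= M'.
  move=> m0 M0 [F [r [conv loc]]]; split.
    exact: (digit_count_lower_bound a b m' M' ab m0 M0 F conv r loc).
  exact: (base_den_le_max_digit a b m' M' ab m0 M0 F conv).
move=> mM0 conv; have convN := carry_conversion_opp _ _ _ _ conv.
have posM : 0 < M -> a + b <= M - m + 1 /\ b <= M by move=> M0; apply: main => //; lia.
have negm : m < 0 -> a + b <= - m - - M + 1 /\ b <= - m by move=> m0; apply: main => //; lia.
split=> [|/posM[]//|/negm[]]; last lia.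
by case/orP: mM0 => [/negm|/posM]; lia.
Qed.

Theorem theorem46 (R : realType) (a b : nat) (hab : coprime a b)
    (hba : (b < a)%N) (hb : (1 <= b)%N) (A : {fset R[i]})
    (hA : minimal_contiguous_parallel_alphabet (a%:R / b%:R : R[i]) A) :
  #|` A|%fset = (a + b)%N /\
  [\/ [set` A] = int_range R 0 (a%:Z + b%:Z - 1),
      [set` A] = int_range R (- a%:Z - b%:Z + 1) 0 |
      exists2 d : nat, [set` A] = int_range R (- d%:Z) (a%:Z + b%:Z - 1 - d%:Z)
        & int_range R (- b%:Z) b%:Z `<=` [set` A] ].
Proof.
have [[[m [M AE]] A0 [x xA x0] parA] minA] := hA.
have a0 : (0 < a)%N by lia.
have mM := range_le0 R A m M AE A0.
have [lbA bM bm] : [/\ a%:Z + b%:Z <= M - m + 1, 0 < M -> b%:Z <= M & m < 0 -> m <= - b%:Z].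
  apply: carry_conversion_bounds => //; first lia.
    move: (xA) (x0); rewrite (int_digitE R A m M AE x xA) (mem_int_range R A m M AE) intr_eq0.
    lia.
  exact: (carry_conversion_of_parallel R a b a0 hb hab A m M AE A0).
have cardA : #|` A|%:Z = M - m + 1 by apply: (card_int_range R); rewrite // ; lia.
(* This competitor has [a + b] digits, so minimality caps the size of [A]. *)
pose B := int_fset R (- b%:Z) (a + b).
have BE : [set` B] = int_range R (- b%:Z) (a%:Z - 1) by apply: int_fsetE; lia.
have memB (k : int) : (k%:~R \in B) = (- b%:Z <= k <= a%:Z - 1) := mem_int_range R B _ _ BE k.
have B0 : 0 \in B by rewrite -(mulr0z 1) memB; lia.
have parB : contiguous_parallel_alphabet (a%:R / b%:R : R[i]) B.
  split=> //; first by exists (- b%:Z), (a%:Z - 1).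
    by exists (1 : int)%:~R; [rewrite memB; lia|rewrite oner_eq0].
  exact: symmetric_alphabet_parallel.
have := minA B parB; rewrite card_int_fset => ubA.
have ME : M = m + a%:Z + b%:Z - 1 by lia.
split; first lia.
(* If neither end is 0, then [m < 0 < M], and [bm] and [bM] give [m <= - b] and [b <= M]. *)
have [m0|m0] := eqVneq m 0; first by apply: Or31; rewrite AE ME m0; congr int_range; lia.
have [M0|M0] := eqVneq M 0; first by apply: Or32; rewrite AE M0; congr int_range; lia.
apply: Or33; exists `|m|%N; first by rewrite AE; congr int_range; lia.
by rewrite AE => y [k /= kb <-]; exists k => //=; lia.
Qed.
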